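(* Let the sampling operator be $S=S_q$, the QDEIM sampling matrix associated with an orthonormal POD basis $U_q\in\mathbb{R}^{n\times q}$, and set $\Pi_q:=U_qU_q^\top$, $B_q:=S_qU_q$, $\kappa_q:=\lVert B_q^{-1}\rVert_2=1/\sigma_{\min}(B_q)$ and $$\Gamma_q(\tau):=\frac{\kappa_q}{\sqrt{1-\tau^2}-\sqrt{\kappa_q^2-1}\,\tau},\qquad 0\le\tau<1/\kappa_q .$$ Let $x\in\mathbb{R}^n$, $\eta\in\mathbb{R}^q$, fix $y=S_qx+\eta$, and let $\mathcal F(\cdot;y)$ be the Gappy PMD reconstruction map with search set $\Theta$ (defined in the context). Assume that $\Theta$ is compact, that $G(\theta;y):=D_\theta\mathcal F(\theta;y)$ is continuous with constant rank $1\le p:=\operatorname{rank}G(\theta;y)\le q$ on $\Theta$, and that $\kappa_q\tau_q(\theta;y)<1$ for every $\theta\in\Theta$, where $$\tau_q(\theta;y):=\lVert(I-\Pi_q)G(\theta;y)G(\theta;y)^\dagger\rVert_2 .$$ Let $\tau_{q,*}:=\max_{\theta\in\Theta}\tau_q(\theta;y)$, and let $\Lambda_{\mathcal T}(\theta;y):=\lVert(S_q\Psi(\theta;y))^\dagger\rVert_2=1/\sigma_{\min}(S_q\Psi(\theta;y))$, where the columns of $\Psi(\theta;y)\in\mathbb{R}^{n\times p}$ form any orthonormal basis of $\operatorname{range}G(\theta;y)$. Then $$\sup_{\theta\in\Theta}\Lambda_{\mathcal T}(\theta;y)\le\Gamma_q(\tau_{q,*})<\infty,$$ and for all $\widetilde\theta\in\Theta$,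 $$\lVert\widetilde e\rVert_2\le\Gamma_q(\tau_{q,*})\bigl(\lVert\widetilde e_\perp\rVert_2+\lVert\eta\rVert_2\bigr)+\Gamma_q(\tau_{q,*})^2\,\lVert\widetilde r_{\mathrm{stat}}\rVert_2,$$ where, with $\widetilde x:=\mathcal F(\widetilde\theta;y)$ and $\widetilde\Psi:=\Psi(\widetilde\theta;y)$, $$\widetilde e:=x-\widetilde x,\qquad \widetilde e_\perp:=(I-\widetilde\Psi\widetilde\Psi^\top)\widetilde e,\qquad \widetilde r_{\mathrm{stat}}:=\widetilde\Psi^\top S_q^\top(y-S_q\widetilde x).$$ More generally, consider a sequence of such problems indexed by $j$, where for every $j$, with all quantities being those of the $j$-th problem, the sampling operator is the QDEIM sampling matrix $S_q$ associated with the orthonormal POD basis $U_q$, the search set $\Theta$ is compact, the Jacobian $G(\theta;y)=D_\theta\mathcal F(\theta;y)$ is continuous in $\theta$ with constant rank $p$, $1\le p\le q$, on $\Theta$, and $\kappa_q\tau_q(\theta;y)<1$ for every $\theta\in\Theta$; let the $j$-th problem have stability constant $\Gamma_q(\tau_{q,*,j})$ (the constant $\Gamma_q(\tau_{q,*})$ of the $j$-th problem), noise $\eta_j$, and, at a recovered point $\widetilde\theta_j$ in the search set of the $j$-th problem, corresponding error $\widetilde e_j$, local normal component $\widetilde e_{\perp,j}$ and stationarity residual $\widetilde r_{\mathrm{stat},j}$. If $\sup_j\Gamma_q(\tau_{q,*,j})<\infty$, $\lVert\widetilde e_{\perp,j}\rVert_2\to0$, $\lVert\eta_j\rVert_2\to0$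 and $\lVert\widetilde r_{\mathrm{stat},j}\rVert_2\to0$, then $\lVert\widetilde e_j\rVert_2\to0$.
   Context: Notation: $\lVert\cdot\rVert_2$ is the Euclidean norm of vectors and the spectral norm of matrices; $A^\dagger$ is the Moore--Penrose inverse; $\sigma_{\min}(A)$ is the smallest singular value of a matrix $A$ with at least as many rows as columns. QDEIM: $U_q\in\mathbb{R}^{n\times q}$ is an orthonormal POD basis (leading left singular vectors of the centered snapshot matrix), so $U_q^\top U_q=I_q$. A sampling matrix $S\in\mathbb{R}^{q\times n}$ extracts the entries with distinct indices $i_1,\dots,i_q$, i.e. its rows are the standard basis row vectors $e_{i_1}^\top,\dots,e_{i_q}^\top$; hence $SS^\top=I_q$. The QDEIM sampling matrix $S_q$ is the one whose indices are the first $q$ pivots of a column-pivoted QR factorization of $U_q^\top$; this construction ensures that $B_q=S_qU_q$ is nonsingular, so $\kappa_q$ is finite. The measurement of a full state $x\in\mathbb{R}^n$ is $y=Sx+\eta$ with noise $\eta\in\mathbb{R}^q$. Gappy PMD (offline). From training snapshots $x_1,\dots,x_m\in\mathbb{R}^n$ let $\bar x$ be their mean, let $\Phi\in\mathbb{R}^{n\times r}$ consist of the $r$ leading left singular vectors of $[x_1-\bar x,\dots,x_m-\bar x]$ (so $\Phi^\top\Phi=I_r$), and put $a_j=\Phi^\top(x_j-\bar x)\in\mathbb{R}^r$, $u_j=x_j-\bar x-\Phi a_j$, $b_j=Su_j\in\mathbb{R}^q$. Let $d_{\mathcal M}(u_i,u_j)$ be the shortest-path distance in the $k_{\mathrm{nn}}$-nearest-neighbor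 graph of the $u_j$ with Euclidean edge lengths; set $W_{ij}=\exp(-d_{\mathcal M}^2(u_i,u_j)/\varepsilon)$ with $\varepsilon>0$, $\rho_i=\sum_jW_{ij}$, $\widetilde W_{ij}=W_{ij}/(\rho_i\rho_j)$, $P(i,j)=\widetilde W_{ij}/\sum_k\widetilde W_{ik}$. With eigenpairs $P\varphi_k=\lambda_k\varphi_k$, $1=\lambda_0\ge\lambda_1\ge\cdots$, and a step number $t$, the manifold coordinates are $\alpha_j=(\lambda_1^t\varphi_1(j),\dots,\lambda_{r_1}^t\varphi_{r_1}(j))\in\mathbb{R}^{r_1}$. Denote by $\bar\alpha,\bar a,\bar b$ and $\sigma_\alpha,\sigma_a,\sigma_b$ the componentwise means and standard deviations of $\{\alpha_j\},\{a_j\},\{b_j\}$, and standardize componentwise: $\widetilde\alpha=(\alpha-\bar\alpha)/\sigma_\alpha$, $\widetilde a=(a-\bar a)/\sigma_a$, $\widetilde b=(b-\bar b)/\sigma_b$. Put $\xi_j=[\widetilde\alpha_j,\widetilde a_j,\widetilde b_j]\in\mathbb{R}^{r_1+r+q}$. The lift mapping is the Gaussian kernel ridge regression $f(\xi)=\sum_{j=1}^m c_j\exp(-\lVert\xi-\xi_j\rVert_2^2/\varepsilon_f)\in\mathbb{R}^n$, where $\varepsilon_f=c_\varepsilon\operatorname{median}\{\lVert\xi_i-\xi_j\rVert_2^2:i<j\}$ with $c_\varepsilon>0$, and $C=[c_1,\dots,c_m]^\top$ solves $(K+\lambda_fI)C=[u_1,\dots,u_m]^\top$ with $K_{ij}=\exp(-\lVert\xi_i-\xi_j\rVert_2^2/\varepsilon_f)$,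 $\lambda_f>0$. Gappy PMD (online). Let $d=r_1+r$ and write $\theta=[\widetilde\alpha,\widetilde a]\in\mathbb{R}^d$. Let $a(\theta)$ be the physical coefficient vector obtained by undoing the standardization of $\widetilde a$. Put $b(a;y)=y-S\bar x-S\Phi a$, $\xi(\theta)=[\widetilde\alpha,\widetilde a,\widetilde b]$ with $\widetilde b$ the standardization of $b(a(\theta);y)$, and $$\mathcal F(\theta;y):=\bar x+\Phi a(\theta)+f(\xi(\theta))\in\mathbb{R}^n .$$ $D_\theta\mathcal F(\theta;y)\in\mathbb{R}^{n\times d}$ is its Jacobian in $\theta$ (with $y$ fixed). The search set $\Theta=[\theta_L,\theta_U]\subset\mathbb{R}^d$ is a box obtained by expanding the range of the training coordinates by a fixed margin. The vector $\widetilde e_{\perp,j}$ is the local normal component at the recovered point of the $j$-th problem; it is not, by itself, a global PMD approximation error. *)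

(* Defs.v *)
From HB Require Import structures.
From mathcomp Require Import all_boot all_order all_algebra perm.
From mathcomp Require Import all_classical all_reals all_analysis.

Set Implicit Arguments.
Unset Strict Implicit.
Unset Printing Implicit Defensive.

Import Order.TTheory GRing.Theory Num.Theory.
Import numFieldNormedType.Exports.

Local Open Scope classical_set_scope.
Local Open Scope ring_scope.

(* The library norm on matrices is the sup norm (with the same topology), hence
   the explicit Euclidean norm. *)
Definition norm2 (R : realType) (n : nat) (v : 'cV[R]_n) : R :=
  Num.sqrt (\sum_i v i 0 ^+ 2).

Definition specnorm (R : realType) (m n : nat) (A : 'M[R]_(m, n)) : R :=
  sup [set norm2 (A *m v) | v in [set v : 'cV[R]_n | norm2 v <= 1]].

Definition penrose (R : realType) (m n : nat) (A : 'M[R]_(m, n))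
    (X : 'M[R]_(n, m)) : Prop :=
  [/\ A *m X *m A = A, X *m A *m X = X,
      (A *m X)^T = A *m X & (X *m A)^T = X *m A].

(* Moore-Penrose inverse: the unique solution of the four Penrose equations. *)
Definition pinv2 (R : realType) (m n : nat) (A : 'M[R]_(m, n)) : 'M[R]_(n, m) :=
  xget 0 [set X | penrose A X].

(* Intended for matrices with at least as many rows as columns, for which
   the singular values are exactly the roots of the eigenvalues of A^T A. *)
Definition singular_value (R : realType) (m n : nat) (A : 'M[R]_(m, n))
    (s : R) : Prop :=
  0 <= s /\ eigenvalue (A^T *m A) (s ^+ 2).

Definition sigma_min (R : realType) (m n : nat) (A : 'M[R]_(m, n)) : R :=
  inf [set s | singular_value A s].

(* Full singular value decomposition A = W D V^T. *)
Definition svd (R : realType) (n m : nat) (A : 'M[R]_(n, m))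
    (W : 'M[R]_n) (D : 'M[R]_(n, m)) (V : 'M[R]_m) : Prop :=
  [/\ W^T *m W = 1%:M, V^T *m V = 1%:M, A = W *m D *m V^T,
      (forall (i : 'I_n) (j : 'I_m), i <> j :> nat -> D i j = 0) &
      (forall (i : 'I_n) (j : 'I_m), i = j :> nat -> 0 <= D i j) /\
      (forall (i i' : 'I_n) (j j' : 'I_m), i = j :> nat -> i' = j' :> nat ->
         (i <= i')%N -> D i' j' <= D i j)].

Definition leading_left_singular (R : realType) (n m k : nat)
    (A : 'M[R]_(n, m)) (U : 'M[R]_(n, k)) : Prop :=
  (k <= n)%N /\
  exists W D V, svd A W D V /\
    forall (i : 'I_n) (j : 'I_k) (l : 'I_n), l = j :> nat -> U i j = W i l.

Definition same_range (R : realType) (n p d : nat)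
    (A : 'M[R]_(n, p)) (B : 'M[R]_(n, d)) : Prop := (A^T == B^T)%MS.

Definition orthonormal_range_basis (R : realType) (n d p : nat)
    (G : 'M[R]_(n, d)) (Psi : 'M[R]_(n, p)) : Prop :=
  Psi^T *m Psi = 1%:M /\ same_range Psi G.

(* The library Jacobian ['J] acts on row vectors, on the right. *)
Definition cjacobian (R : realType) (d n : nat) (f : 'cV[R]_d -> 'cV[R]_n)
    (theta : 'cV[R]_d) : 'M[R]_(n, d) :=
  ('J (fun v : 'rV[R]_d => (f v^T)^T) theta^T)^T.

(* Column-pivoted QR factorization A P = Q T. As T is upper trapezoidal, the
   last condition says that the k-th pivot has, among the remaining columns,
   maximal norm orthogonally to the previous pivots (greedy pivoting). *)
Definition pivoted_qr (R : realType) (q n : nat) (A : 'M[R]_(q, n))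
    (s : 'S_n) (Q : 'M[R]_q) (T : 'M[R]_(q, n)) : Prop :=
  [/\ Q^T *m Q = 1%:M, col_perm s A = Q *m T,
      (forall (i : 'I_q) (j : 'I_n), (j < i)%N -> T i j = 0) &
      (forall (k : 'I_q) (l j : 'I_n), l = k :> nat -> (k <= j)%N ->
         \sum_(i < q | (k <= i)%N) T i j ^+ 2 <=
         \sum_(i < q | (k <= i)%N) T i l ^+ 2)].

Definition sampling_mx (R : realType) (q n : nat) (idx : 'I_q -> 'I_n) :
  'M[R]_(q, n) := \matrix_(k, j) (idx k == j)%:R.

(* In [col_perm s A] column l is column [s l] of A. *)
Definition qdeim_indices (R : realType) (n q : nat) (U : 'M[R]_(n, q))
    (idx : 'I_q -> 'I_n) : Prop :=
  exists s Q T, pivoted_qr U^T s Q T /\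
    forall (k : 'I_q) (l : 'I_n), l = k :> nat -> idx k = s l.

(* Samples are stored as the columns of a matrix. *)
Definition colmean (R : realType) (k m : nat) (Y : 'M[R]_(k, m)) : 'cV[R]_k :=
  \col_i (m%:R^-1 * \sum_j Y i j).

(* Population (1/m) convention. *)
Definition colsd (R : realType) (k m : nat) (Y : 'M[R]_(k, m)) : 'cV[R]_k :=
  \col_i Num.sqrt (m%:R^-1 * \sum_j (Y i j - colmean Y i 0) ^+ 2).

Definition standardize (R : realType) (k m : nat) (Y : 'M[R]_(k, m))
    (v : 'cV[R]_k) : 'cV[R]_k :=
  \col_i ((v i 0 - colmean Y i 0) / colsd Y i 0).

Definition unstandardize (R : realType) (k m : nat) (Y : 'M[R]_(k, m))
    (v : 'cV[R]_k) : 'cV[R]_k :=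
  \col_i (colmean Y i 0 + colsd Y i 0 * v i 0).

Definition centered (R : realType) (k m : nat) (Y : 'M[R]_(k, m)) :
  'M[R]_(k, m) := \matrix_(i, j) (Y i j - colmean Y i 0).

Definition median (R : realType) (s : seq R) : R :=
  let t := sort <=%R s in (t`_((size s).-1./2) + t`_((size s)./2)) / 2.

(* nbr i is a set of k nearest neighbours of column i (ties are broken
   arbitrarily). *)
Definition knn_sets (R : realType) (n m : nat) (u : 'M[R]_(n, m)) (k : nat)
    (nbr : 'I_m -> {set 'I_m}) : Prop :=
  forall i, [/\ i \notin nbr i, #|nbr i| = k &
    forall j l, j \in nbr i -> l \notin nbr i -> l <> i ->
      norm2 (col j u - col i u) <= norm2 (col l u - col i u)].

Definition knn_edge (m : nat) (nbr : 'I_m -> {set 'I_m}) : rel 'I_m :=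
  fun i j => (j \in nbr i) || (i \in nbr j).

Fixpoint path_length (R : realType) (n m : nat) (u : 'M[R]_(n, m))
    (i : 'I_m) (s : seq 'I_m) : R :=
  if s is j :: s' then norm2 (col i u - col j u) + path_length u j s' else 0.

(* +oo between different connected components. *)
Definition graph_dist (R : realType) (n m : nat) (u : 'M[R]_(n, m))
    (nbr : 'I_m -> {set 'I_m}) (i j : 'I_m) : \bar R :=
  ereal_inf [set (path_length u i s)%:E | s in
    [set s : seq 'I_m | path (knn_edge nbr) i s /\ last i s = j]].

Definition affinity (R : realType) (n m : nat) (u : 'M[R]_(n, m))
    (nbr : 'I_m -> {set 'I_m}) (eps : R) : 'M[R]_m :=
  \matrix_(i, j)
    fine (expeR (- (graph_dist u nbr i j ^+ 2 * (eps^-1)%:E))%E).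

Definition density_normalize (R : realType) (m : nat) (W : 'M[R]_m) : 'M[R]_m :=
  \matrix_(i, j) (W i j / ((\sum_k W i k) * (\sum_k W j k))).

Definition row_normalize (R : realType) (m : nat) (W : 'M[R]_m) : 'M[R]_m :=
  \matrix_(i, j) (W i j / \sum_k W i k).

(* A full system of eigenpairs of P, counted with multiplicity; only the
   indices k < m of lam and phi are meaningful. *)
Definition eigensystem (R : realType) (m : nat) (P : 'M[R]_m)
    (lam : nat -> R) (phi : nat -> 'cV[R]_m) : Prop :=
  [/\ (forall k, (k < m)%N -> P *m phi k = lam k *: phi k),
      (\matrix_(i < m, k < m) phi k i 0) \in unitmx,
      lam 0%N = 1 &
      (forall k l, (k <= l < m)%N -> lam l <= lam k)].

Definition diffusion_coords (R : realType) (m r1 : nat) (t : nat)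
    (lam : nat -> R) (phi : nat -> 'cV[R]_m) : 'M[R]_(r1, m) :=
  \matrix_(k < r1, j < m) (lam k.+1 ^+ t * phi k.+1 j 0).

Record gpmd_data (R : realType) (n m q r r1 : nat) : Type := GpmdData {
  snap    : 'M[R]_(n, m);          (* the columns are x_1, ..., x_m *)
  podU    : 'M[R]_(n, q);
  pivots  : 'I_q -> 'I_n;      
  Phi     : 'M[R]_(n, r);
  knn     : nat;
  nbr     : 'I_m -> {set 'I_m};    (* chosen nearest-neighbour sets *)
  eps     : R;
  lam     : nat -> R;
  phi     : nat -> 'cV[R]_m;
  steps   : nat;
  c_eps   : R;
  lam_f   : R;
  coef    : 'M[R]_(m, n);          (* the matrix C with rows c_j^T *)
  margin  : 'cV[R]_(r1 + r)        (* box margin in each coordinate *)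
}.

Section Offline.
Context (R : realType) (n m q r r1 : nat) (D : gpmd_data R n m q r r1).

Definition Sq : 'M[R]_(q, n) := sampling_mx R (pivots D).

Definition Piq : 'M[R]_n := podU D *m (podU D)^T.

Definition Bq : 'M[R]_q := Sq *m podU D.

Definition kappa : R := specnorm (invmx Bq).

Definition xbar : 'cV[R]_n := colmean (snap D).

Definition a_mx : 'M[R]_(r, m) := (Phi D)^T *m centered (snap D).

Definition u_mx : 'M[R]_(n, m) := centered (snap D) - Phi D *m a_mx.

Definition b_mx : 'M[R]_(q, m) := Sq *m u_mx.

Definition transition : 'M[R]_m :=
  row_normalize (density_normalize (affinity u_mx (nbr D) (eps D))).

Definition alpha_mx : 'M[R]_(r1, m) :=
  diffusion_coords r1 (steps D) (lam D) (phi D).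

Definition train (j : 'I_m) : 'cV[R]_(r1 + r) :=
  col_mx (standardize alpha_mx (col j alpha_mx))
         (standardize a_mx (col j a_mx)).

Definition xi_train (j : 'I_m) : 'cV[R]_(r1 + r + q) :=
  col_mx (train j) (standardize b_mx (col j b_mx)).

Definition eps_f : R :=
  c_eps D * median [seq norm2 (xi_train p.1 - xi_train p.2) ^+ 2
                   | p : 'I_m * 'I_m <- enum {: 'I_m * 'I_m} & (p.1 < p.2)%N].

Definition gauss (v w : 'cV[R]_(r1 + r + q)) : R :=
  expR (- (norm2 (v - w) ^+ 2 / eps_f)).

Definition kernel_mx : 'M[R]_m :=
  \matrix_(i, j) gauss (xi_train i) (xi_train j).

Definition lift_map (v : 'cV[R]_(r1 + r + q)) : 'cV[R]_n :=
  \sum_(j < m) gauss v (xi_train j) *: (row j (coef D))^T.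

Definition theta_lo : 'cV[R]_(r1 + r) :=
  \col_i (inf (range (fun j => train j i 0)) - margin D i 0).

Definition theta_hi : 'cV[R]_(r1 + r) :=
  \col_i (sup (range (fun j => train j i 0)) + margin D i 0).

Definition Theta : set 'cV[R]_(r1 + r) :=
  [set theta | forall i, theta_lo i 0 <= theta i 0 <= theta_hi i 0].

Record gappy_pmd : Prop := GappyPMD {
  gpmd_pod    : leading_left_singular (centered (snap D)) (podU D);
  gpmd_qdeim  : qdeim_indices (podU D) (pivots D);
  gpmd_Phi    : leading_left_singular (centered (snap D)) (Phi D);
  gpmd_knn    : knn_sets u_mx (knn D) (nbr D);
  gpmd_eps    : 0 < eps D;
  gpmd_eigen  : eigensystem transition (lam D) (phi D);
  gpmd_r1     : (r1 < m)%N;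
  gpmd_c_eps  : 0 < c_eps D;
  gpmd_lam_f  : 0 < lam_f D;
  gpmd_ridge  : (kernel_mx + (lam_f D)%:M) *m coef D = u_mx^T;
  gpmd_margin : forall i, 0 <= margin D i 0
}.

End Offline.

Section Online.
Context (R : realType) (n m q r r1 : nat) (D : gpmd_data R n m q r r1).

Definition measure_state (x : 'cV[R]_n) (eta : 'cV[R]_q) : 'cV[R]_q :=
  Sq D *m x + eta.

Definition a_of (theta : 'cV[R]_(r1 + r)) : 'cV[R]_r :=
  unstandardize (a_mx D) (dsubmx theta).

Definition b_of (a : 'cV[R]_r) (y : 'cV[R]_q) : 'cV[R]_q :=
  y - Sq D *m xbar D - Sq D *m Phi D *m a.

Definition xi_of (y : 'cV[R]_q) (theta : 'cV[R]_(r1 + r)) :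
  'cV[R]_(r1 + r + q) :=
  col_mx theta (standardize (b_mx D) (b_of (a_of theta) y)).

Definition recon (y : 'cV[R]_q) (theta : 'cV[R]_(r1 + r)) : 'cV[R]_n :=
  xbar D + Phi D *m a_of theta + lift_map D (xi_of y theta).

Definition Gjac (y : 'cV[R]_q) (theta : 'cV[R]_(r1 + r)) :
  'M[R]_(n, r1 + r) := cjacobian (recon y) theta.

Definition tau_q (y : 'cV[R]_q) (theta : 'cV[R]_(r1 + r)) : R :=
  specnorm ((1%:M - Piq D) *m Gjac y theta *m pinv2 (Gjac y theta)).

(* As a supremum; that it is attained is part of the theorem. *)
Definition tau_star (y : 'cV[R]_q) : R := sup (tau_q y @` Theta D).

Definition tangent_assumptions (y : 'cV[R]_q) (p : nat) : Prop :=
  [/\ compact (Theta D), {within Theta D, continuous (Gjac y)},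
      (1 <= p <= q)%N,
      (forall theta, Theta D theta -> \rank (Gjac y theta) = p) &
      (forall theta, Theta D theta -> kappa D * tau_q y theta < 1)].

Definition Lambda (p : nat) (Psi : 'M[R]_(n, p)) : R :=
  specnorm (pinv2 (Sq D *m Psi)).

Definition err (x : 'cV[R]_n) (y : 'cV[R]_q) (theta : 'cV[R]_(r1 + r)) :
  'cV[R]_n := x - recon y theta.

Definition err_perp (p : nat) (Psi : 'M[R]_(n, p)) (x : 'cV[R]_n)
    (y : 'cV[R]_q) (theta : 'cV[R]_(r1 + r)) : 'cV[R]_n :=
  (1%:M - Psi *m Psi^T) *m err x y theta.

Definition r_stat (p : nat) (Psi : 'M[R]_(n, p)) (y : 'cV[R]_q)
    (theta : 'cV[R]_(r1 + r)) : 'cV[R]_p :=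
  Psi^T *m (Sq D)^T *m (y - Sq D *m recon y theta).

End Online.

(* Gamma is only meaningful where its denominator is positive, i.e. for
   0 <= tau < 1/kappa; since x / 0 = 0 here, "Gamma is finite" must be
   read as 0 < Gamma_den. *)
Definition Gamma_den (R : realType) (kap tau : R) : R :=
  Num.sqrt (1 - tau ^+ 2) - Num.sqrt (kap ^+ 2 - 1) * tau.

Definition Gamma (R : realType) (kap tau : R) : R := kap / Gamma_den kap tau.

(* Main.v *)
(* With [v] in the tangent space range(G), write [v = Pi_q v + (1 - Pi_q) v].
   The first part is seen by the sampling through B_q, with lower bound
   1/kappa_q; the second has norm at most tau |v|, and sampling it costs at most
   the factor sqrt(1 - 1/kappa_q^2), since
     (S (1 - Pi_q)) (S (1 - Pi_q))^T = 1 - B_q B_q^T.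
   Hence |v| <= Gamma_q(tau) |S v| on the tangent space. The error splits as
     e = (1 - Psi (S Psi)^+ S) e_perp - Psi (S Psi)^+ eta
         + Psi ((S Psi)^T S Psi)^-1 r_stat,
   which gives the error bound. The maximum tau_* is attained because, at
   constant rank, tau_q depends continuously on the Jacobian. *)
Require Import Defs.
From HB Require Import structures.
From mathcomp Require Import all_boot all_order all_algebra perm.
From mathcomp Require Import all_classical all_reals all_analysis.
From mathcomp Require Import lra.

Set Implicit Arguments.
Unset Strict Implicit.
Unset Printing Implicit Defensive.

Import Order.TTheory GRing.Theory Num.Theory.
Import numFieldNormedType.Exports.

Local Open Scope classical_set_scope.
Local Open Scope ring_scope.

(** * Euclidean inner product and norm, operator bounds, spectral norm *)

Section EuclideanNorm.
Context {R : realType}.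

Definition dotv (n : nat) (u v : 'cV[R]_n) : R := (u^T *m v) 0 0.

(** For [c >= 0] this says that the spectral norm is at most [c], in a form free of suprema that
    composes and transposes directly. *)
Definition opbound (m n : nat) (A : 'M[R]_(m, n)) (c : R) : Prop :=
  forall v, norm2 (A *m v) <= c * norm2 v.

Lemma dotvE n (u v : 'cV[R]_n) : dotv u v = \sum_i u i 0 * v i 0.
Proof. by rewrite /dotv mxE; apply: eq_bigr => i _; rewrite mxE. Qed.

Lemma dotvC n (u v : 'cV[R]_n) : dotv u v = dotv v u.
Proof. by rewrite !dotvE; apply: eq_bigr => i _; rewrite mulrC. Qed.

Lemma dotvDr n (u v w : 'cV[R]_n) : dotv u (v + w) = dotv u v + dotv u w.
Proof. by rewrite /dotv mulmxDr mxE. Qed.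

Lemma dotvNr n (u v : 'cV[R]_n) : dotv u (- v) = - dotv u v.
Proof. by rewrite /dotv mulmxN mxE. Qed.

Lemma dotvZr n a (u v : 'cV[R]_n) : dotv u (a *: v) = a * dotv u v.
Proof. by rewrite /dotv -scalemxAr mxE. Qed.

Lemma dotvDl n (u v w : 'cV[R]_n) : dotv (u + v) w = dotv u w + dotv v w.
Proof. by rewrite dotvC dotvDr !(dotvC w). Qed.

Lemma dotvNl n (u v : 'cV[R]_n) : dotv (- u) v = - dotv u v.
Proof. by rewrite dotvC dotvNr dotvC. Qed.

Lemma dotvZl n a (u v : 'cV[R]_n) : dotv (a *: u) v = a * dotv u v.
Proof. by rewrite dotvC dotvZr dotvC. Qed.

Definition dotv_linear := (dotvDl, dotvDr, dotvNl, dotvNr, dotvZl, dotvZr).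

Lemma dotv_mulmxl m n (A : 'M[R]_(m, n)) u v :
  dotv (A *m u) v = dotv u (A^T *m v).
Proof. by rewrite /dotv trmx_mul mulmxA. Qed.

Lemma dotv_mulmxr m n (A : 'M[R]_(m, n)) u v :
  dotv u (A *m v) = dotv (A^T *m u) v.
Proof. by rewrite dotvC dotv_mulmxl dotvC. Qed.

Lemma norm2_ge0 n (v : 'cV[R]_n) : 0 <= norm2 v.
Proof. exact: sqrtr_ge0. Qed.
Hint Resolve norm2_ge0 : core.

Lemma sqr_norm2 n (v : 'cV[R]_n) : norm2 v ^+ 2 = dotv v v.
Proof.
rewrite sqr_sqrtr; last by apply: sumr_ge0 => i _; exact: sqr_ge0.
by rewrite dotvE; apply: eq_bigr => i _; rewrite expr2.
Qed.

Lemma norm2_eq0 n (v : 'cV[R]_n) : (norm2 v == 0) = (v == 0).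
Proof.
apply/eqP/eqP => [v0|->].
  have s0 : \sum_i v i 0 ^+ 2 = 0.
    by rewrite -[LHS]sqr_sqrtr -/(norm2 v) ?v0 ?expr0n// sumr_ge0// => i _;
      exact: sqr_ge0.
  apply/matrixP => i j; rewrite ord1 mxE.
  have /eqP := s0; rewrite psumr_eq0; last by move=> k _; exact: sqr_ge0.
  by move=> /allP /(_ i (mem_index_enum _)); rewrite sqrf_eq0 => /eqP.
by rewrite /norm2 big1 ?sqrtr0// => i _; rewrite mxE expr0n.
Qed.

Lemma norm2_0 n : norm2 (0 : 'cV[R]_n) = 0.
Proof. by apply/eqP; rewrite norm2_eq0. Qed.

Lemma exists_norm2_gt0 n : (0 < n)%N -> exists v : 'cV[R]_n, 0 < norm2 v.
Proof.
move=> n0; exists (const_mx 1); rewrite lt0r norm2_ge0 andbT norm2_eq0.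
apply/eqP => /matrixP /(_ (Ordinal n0) 0); rewrite !mxE => /eqP.
by rewrite oner_eq0.
Qed.

Lemma norm2_le n m (u : 'cV[R]_n) (v : 'cV[R]_m) :
  (norm2 u <= norm2 v) = (dotv u u <= dotv v v).
Proof. by rewrite -!sqr_norm2 ler_sqr ?nnegrE. Qed.

Lemma norm2_leM n m c (u : 'cV[R]_n) (v : 'cV[R]_m) : 0 <= c ->
  (norm2 u <= c * norm2 v) = (dotv u u <= c ^+ 2 * dotv v v).
Proof. by move=> c0; rewrite -!sqr_norm2 -exprMn ler_sqr ?nnegrE// mulr_ge0. Qed.

Lemma norm2N n (v : 'cV[R]_n) : norm2 (- v) = norm2 v.
Proof. by apply/eqP; rewrite eq_le !norm2_le !dotv_linear opprK lexx. Qed.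

Lemma norm2Z n a (v : 'cV[R]_n) : norm2 (a *: v) = `|a| * norm2 v.
Proof.
apply/eqP; rewrite -(eqrXn2 (n:=2))// ?mulr_ge0//.
by rewrite exprMn !sqr_norm2 !dotv_linear mulrA -expr2 real_normK ?num_real.
Qed.

(** The squared norm of [dotv v v *: u - dotv u v *: v] is nonnegative; the factor [dotv v v] then
    cancels. *)
Lemma cauchy_schwarz n (u v : 'cV[R]_n) : dotv u v <= norm2 u * norm2 v.
Proof.
have [->|v0] := eqVneq v 0.
  by rewrite norm2_0 mulr0 -(scale0r (0 : 'cV[R]_n)) dotvZr mul0r.
have vv : 0 < dotv v v.
  by rewrite -sqr_norm2 exprn_gt0// lt0r norm2_eq0 v0 norm2_ge0.
have := sqr_ge0 (norm2 (dotv v v *: u - dotv u v *: v)).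
rewrite sqr_norm2 !dotv_linear (dotvC v u) => h.
have {}h : 0 <= dotv v v * (dotv u u * dotv v v - dotv u v ^+ 2) by lra.
rewrite pmulr_rge0// subr_ge0 in h.
apply: (le_trans (ler_norm _)).
rewrite -(ler_pXn2r (n:=2))// ?nnegrE ?mulr_ge0//.
by rewrite exprMn !sqr_norm2 real_normK ?num_real.
Qed.

Lemma norm2D n (u v : 'cV[R]_n) : norm2 (u + v) <= norm2 u + norm2 v.
Proof.
rewrite -(ler_pXn2r (n:=2))// ?nnegrE ?addr_ge0//.
rewrite sqr_norm2 !dotv_linear (dotvC v u) sqrrD !sqr_norm2.
have := cauchy_schwarz u v; lra.
Qed.

Lemma norm2B n (u v : 'cV[R]_n) : norm2 (u - v) <= norm2 u + norm2 v.
Proof. by rewrite -(norm2N v) norm2D. Qed.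

Lemma coord_le_norm2 n (v : 'cV[R]_n) i : `|v i 0| <= norm2 v.
Proof.
rewrite -(ler_pXn2r (n:=2))// ?nnegrE// real_normK ?num_real//.
rewrite sqr_norm2 dotvE (bigD1 i)//= -expr2 lerDl.
by apply: sumr_ge0 => k _; rewrite -expr2 sqr_ge0.
Qed.

Lemma norm2_le_l1 n (v : 'cV[R]_n) : norm2 v <= \sum_i `|v i 0|.
Proof.
rewrite -(ler_pXn2r (n:=2))// ?nnegrE ?sumr_ge0//.
rewrite sqr_norm2 dotvE expr2 mulr_suml; apply: ler_sum => i _.
rewrite -expr2 -real_normK ?num_real// expr2 ler_wpM2l//.
by rewrite (bigD1 i)//= lerDl sumr_ge0.
Qed.

(** Crude, but it makes the supremum in [specnorm] finite, and it later turns entrywise closeness of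
    matrices into closeness as operators. *)
Lemma opbound_l1 m n (A : 'M[R]_(m, n)) : opbound A (\sum_i \sum_j `|A i j|).
Proof.
move=> v; apply: (le_trans (norm2_le_l1 _)); rewrite mulr_suml.
apply: ler_sum => i _; rewrite mxE mulr_suml.
apply: (le_trans (ler_norm_sum _ _ _)); apply: ler_sum => j _.
by rewrite normrM ler_wpM2l// coord_le_norm2.
Qed.

Lemma opbound_exists m n (A : 'M[R]_(m, n)) : exists2 c, 0 < c & opbound A c.
Proof.
have s0 : 0 <= \sum_i \sum_j `|A i j|.
  by apply: sumr_ge0 => i _; exact: sumr_ge0.
exists (1 + \sum_i \sum_j `|A i j|); first by rewrite ltr_wpDr.
move=> v; apply: (le_trans (opbound_l1 A v)).
by rewrite ler_wpM2r// lerDr.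
Qed.

Lemma opboundM m n p (A : 'M[R]_(m, n)) (B : 'M[R]_(n, p)) a b :
  0 <= a -> opbound A a -> opbound B b -> opbound (A *m B) (a * b).
Proof.
move=> a0 hA hB v; rewrite -mulmxA (le_trans (hA _))//.
by rewrite -mulrA ler_wpM2l.
Qed.

(** [|A^T v|^2 = <v, A A^T v> <= c |v| |A^T v|]; divide by [|A^T v|]. *)
Lemma opbound_tr m n (A : 'M[R]_(m, n)) c : 0 <= c ->
  opbound A c -> opbound A^T c.
Proof.
move=> c0 hA v; have [->|w0] := eqVneq (A^T *m v) 0.
  by rewrite norm2_0 mulr_ge0.
have w1 : 0 < norm2 (A^T *m v) by rewrite lt0r norm2_eq0 w0 norm2_ge0.
rewrite -(ler_pM2r w1) -expr2 sqr_norm2 -dotv_mulmxr.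
rewrite (le_trans (cauchy_schwarz _ _))// (mulrAC c) mulrC.
by rewrite ler_wpM2r.
Qed.

Lemma specnorm_le m n (A : 'M[R]_(m, n)) c : 0 <= c -> opbound A c ->
  specnorm A <= c.
Proof.
move=> c0 hA; apply: ge_sup.
  by exists (norm2 (A *m 0)), 0 => //=; rewrite norm2_0 ler01.
move=> _ [v /= v1 <-]; rewrite (le_trans (hA v))//.
by rewrite ler_piMr.
Qed.

(** The defining set must first be shown bounded, as [sup] of an unbounded set is a default value;
    scaling to norm 1 then gives all vectors. *)
Lemma specnormP m n (A : 'M[R]_(m, n)) : opbound A (specnorm A).
Proof.
have [c c0 hA] := opbound_exists A.
have ub v : norm2 v <= 1 -> norm2 (A *m v) <= specnorm A.
  move=> v1; apply: ub_le_sup; last by exists v.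
  exists c => _ [w /= w1 <-]; rewrite (le_trans (hA w))//.
  by rewrite ler_piMr// ltW.
move=> v; have [->|v0] := eqVneq v 0; first by rewrite mulmx0 !norm2_0 mulr0.
have v1 : 0 < norm2 v by rewrite lt0r norm2_eq0 v0 norm2_ge0.
rewrite -ler_pdivrMr//.
have := ub ((norm2 v)^-1 *: v).
rewrite -scalemxAr !norm2Z ger0_norm ?invr_ge0// mulVf ?gt_eqF// mulrC.
by apply.
Qed.

Lemma specnorm_ge0 m n (A : 'M[R]_(m, n)) : 0 <= specnorm A.
Proof.
apply: (le_trans (norm2_ge0 (A *m 0))).
apply: ub_le_sup; last by exists 0 => //=; rewrite norm2_0 ler01.
have [c c0 hA] := opbound_exists A.
exists c => _ [w /= w1 <-]; rewrite (le_trans (hA w))//.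
by rewrite ler_piMr// ltW.
Qed.

End EuclideanNorm.
Hint Resolve norm2_ge0 specnorm_ge0 : core.

(** * Existence of the pseudoinverse; its norm as the inverse of the smallest singular value *)

Section PseudoInverse.
Context {R : realType}.

(** The quadratic form of the Gram matrix is [|C v|^2], so its kernel is that of [C], trivial by
    full column rank. *)
Lemma gram_unitmx n p (C : 'M[R]_(n, p)) :
  row_free C^T -> C^T *m C \in unitmx.
Proof.
move=> freeC; rewrite -row_free_unit -kermx_eq0; apply/rowV0P => v.
move=> /sub_kermxP vCC0; apply: trmx_inj; rewrite trmx0.
have : norm2 (C *m v^T) == 0.
  rewrite -sqrf_eq0 sqr_norm2 dotv_mulmxl mulmxA.
  have -> : C^T *m C *m v^T = 0.
    by apply: trmx_inj; rewrite !trmx_mul !trmxK trmx0.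
  by rewrite -(scale0r (0 : 'cV[R]_p)) dotvZr mul0r.
rewrite norm2_eq0 => /eqP Cv0.
have : v *m C^T = 0 *m C^T.
  by rewrite mul0mx; apply: trmx_inj; rewrite trmx_mul trmxK Cv0 trmx0.
by move/(row_free_inj freeC) ->; rewrite trmx0.
Qed.

(** Factor [A = C F] with full ranks; the witness is [F^T (F F^T)^-1 (C^T C)^-1 C^T]. *)
Lemma penrose_exists m n (A : 'M[R]_(m, n)) : exists X, penrose A X.
Proof.
have [p [C [F [-> freeC freeF]]]] :
    exists p (C : 'M[R]_(m, p)) (F : 'M[R]_(p, n)),
    [/\ A = C *m F, row_free C^T & row_free F].
  exists (\rank A), (col_base A), (row_base A); rewrite mulmx_base row_base_free.
  by split=> //; rewrite /row_free mxrank_tr; exact: col_base_full.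
have uC := gram_unitmx freeC.
have uF : F *m F^T \in unitmx.
  by have := @gram_unitmx _ _ F^T; rewrite trmxK; apply.
have CC : (invmx (C^T *m C))^T = invmx (C^T *m C).
  by rewrite trmx_inv trmx_mul trmxK.
have FF : (invmx (F *m F^T))^T = invmx (F *m F^T).
  by rewrite trmx_inv trmx_mul trmxK.
pose X := F^T *m invmx (F *m F^T) *m (invmx (C^T *m C) *m C^T).
have AX : C *m F *m X = C *m invmx (C^T *m C) *m C^T.
  by rewrite /X !mulmxA -(mulmxA C F) -(mulmxA C) mulmxV// mulmx1.
have XA : X *m (C *m F) = F^T *m invmx (F *m F^T) *m F.
  rewrite /X -!mulmxA; congr (_ *m (_ *m _)).
  by rewrite (mulmxA C^T) mulmxA mulVmx// mul1mx.
exists X; split.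
- by rewrite AX -!mulmxA (mulmxA C^T) (mulmxA (invmx _)) mulVmx// mul1mx.
- rewrite XA /X -!mulmxA (mulmxA F) (mulmxA (F *m _)) mulmxV// mul1mx.
  by rewrite !mulmxA.
- by rewrite AX !trmx_mul trmxK CC mulmxA.
- by rewrite XA !trmx_mul trmxK FF mulmxA.
Qed.

Lemma pinv2P m n (A : 'M[R]_(m, n)) : penrose A (pinv2 A).
Proof. by have := xgetPex 0 (penrose_exists A). Qed.

(** [|P v|^2 = <v, P v>], then Cauchy-Schwarz. *)
Lemma proj_contract n (P : 'M[R]_n) : P^T = P -> P *m P = P -> opbound P 1.
Proof.
move=> Psym Pidem v; rewrite mul1r.
have [->|w0] := eqVneq (P *m v) 0; first by rewrite norm2_0 norm2_ge0.
have w1 : 0 < norm2 (P *m v) by rewrite lt0r norm2_eq0 w0 norm2_ge0.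
rewrite -(ler_pM2r w1) -expr2 sqr_norm2 dotv_mulmxl Psym mulmxA Pidem.
exact: cauchy_schwarz.
Qed.

Lemma penrose_contract m n (A : 'M[R]_(m, n)) X :
  penrose A X -> opbound (A *m X) 1.
Proof. by move=> [AXA _ s _]; apply: proj_contract => //; rewrite mulmxA AXA. Qed.

Lemma pinv_left_inverse m n (A : 'M[R]_(m, n)) X :
  row_free A^T -> penrose A X -> X *m A = 1%:M.
Proof.
move=> freeA [AXA _ _ _]; apply: trmx_inj; apply: (row_free_inj freeA).
by rewrite -trmx_mul mulmxA AXA trmx1 mul1mx.
Qed.

Lemma penrose_invmx n (A : 'M[R]_n) : A \in unitmx -> penrose A (invmx A).
Proof. by move=> uA; split; rewrite ?(mulmxV, mulVmx)// ?mul1mx// trmx1. Qed.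

(* With [c = specnorm X], the form of [N = M^T M - c^-2] is nonnegative; were
   c^-2 not an eigenvalue, [N] would be invertible, so its form would be bounded
   below by a positive multiple of the square of the norm, improving the bound
   [c] on [X]. *)
Lemma sigma_min_pinv q p (M : 'M[R]_(q, p)) X : (0 < p)%N ->
  penrose M X -> X *m M = 1%:M ->
  0 < sigma_min M /\ specnorm X = (sigma_min M)^-1.
Proof.
move=> p0 pX XM; set c := specnorm X.
have lowM v : norm2 v <= c * norm2 (M *m v).
  by rewrite -{1}(mul1mx v) -XM -mulmxA; exact: specnormP.
have c0 : 0 < c.
  rewrite lt0r specnorm_ge0 andbT; apply/eqP => c0.
  have [v v0] := @exists_norm2_gt0 R _ p0.
  by have := lowM v; rewrite c0 mul0r leNgt v0.
pose s := c^-1; have s0 : 0 < s by rewrite invr_gt0.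
have lowM2 v : s ^+ 2 * dotv v v <= dotv (M *m v) (M *m v).
  rewrite exprVn mulrC ler_pdivrMr ?exprn_gt0// mulrC -norm2_leM ?(ltW c0)//.
pose N := M^T *m M - (s ^+ 2)%:M.
have NE v : dotv v (N *m v) = dotv (M *m v) (M *m v) - s ^+ 2 * dotv v v.
  by rewrite mulmxBl mul_scalar_mx dotvDr dotvNr dotvZr -mulmxA dotv_mulmxl.
have Nsym : N^T = N by rewrite raddfB /= trmx_mul trmxK tr_scalar_mx.
have eig : eigenvalue (M^T *m M) (s ^+ 2).
  rewrite /eigenvalue /eigenspace -/N kermx_eq0 row_free_unit; apply/negP => uN.
  have [k k0 hk] := opbound_exists (invmx N).
  have [L L0 hL] := opbound_exists N.
  (* For a nonnegative form, [|N v|^2 <= L <v, N v>]: evaluate the form at [L v - N v]. *)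
  have QN v : dotv (N *m v) (N *m v) <= L * dotv v (N *m v).
    set w := N *m v.
    have wNw : dotv w (N *m w) <= L * dotv w w.
      rewrite (le_trans (cauchy_schwarz _ _))// -sqr_norm2 expr2 mulrCA.
      by rewrite ler_wpM2l ?norm2_ge0.
    have : 0 <= dotv (L *: v - w) (N *m (L *: v - w)).
      by rewrite NE subr_ge0.
    rewrite mulmxBr -scalemxAr -/w !dotv_linear (dotv_mulmxr N v w) Nsym -/w => h.
    have {}h : 0 <= L * (L * dotv v w - dotv w w) by lra.
    by rewrite pmulr_rge0// subr_ge0 in h.
  (* From [|v|^2 <= k^2 |N v|^2 <= k^2 L <v, N v>]. *)
  pose e := (k ^+ 2 * L)^-1.
  have e0 : 0 < e by rewrite invr_gt0 mulr_gt0// exprn_gt0.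
  have lowM3 v : (s ^+ 2 + e) * dotv v v <= dotv (M *m v) (M *m v).
    have : e * dotv v v <= dotv v (N *m v).
      rewrite /e mulrC ler_pdivrMr ?mulr_gt0 ?exprn_gt0//.
      rewrite -{1 2}(mul1mx v) -(mulVmx uN) -mulmxA.
      have := hk (N *m v); rewrite norm2_leM ?(ltW k0)// => /le_trans; apply.
      by rewrite [leRHS]mulrCA ler_wpM2l ?sqr_ge0// [leRHS]mulrC.
    rewrite NE; lra.
  pose g := (Num.sqrt (s ^+ 2 + e))^-1.
  have se : 0 < s ^+ 2 + e by rewrite addr_gt0// exprn_gt0.
  have g0 : 0 < g by rewrite invr_gt0 sqrtr_gt0.
  have : c <= g.
    apply: specnorm_le => [|v]; first exact: ltW.
    (* The improved lower bound is applied at [X v]; since [M X] is an orthogonal projection,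
       [|M X v| <= |v|]. *)
    have /le_trans : norm2 (X *m v) <= g * norm2 (M *m (X *m v)).
      rewrite norm2_leM ?(ltW g0)// exprVn sqr_sqrtr ?(ltW se)//.
      rewrite mulrC ler_pdivlMr// mulrC.
      exact: lowM3.
    apply; rewrite ler_wpM2l ?(ltW g0)// mulmxA -[leRHS]mul1r.
    exact: penrose_contract.
  rewrite leNgt => /negP; apply.
  rewrite -(invrK c) ltf_pV2 ?posrE ?sqrtr_gt0// -/s.
  by rewrite -[ltLHS](gtr0_norm s0) -sqrtr_sqr ltr_sqrt// ltrDl.
(* [s] is a singular value by [eig]; any other one [t] has an eigenvector [v] with
   [t^2 |v|^2 = |M v|^2 >= s^2 |v|^2]. Eigenvectors are rows in [eigenvalue], hence the
   transposes. *)
have sE : sigma_min M = s.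
  apply/eqP; rewrite eq_le; apply/andP; split.
    apply: ge_inf; last by split => //; rewrite ltW.
    by exists 0 => t [].
  apply: lb_le_inf; first by exists s; split => //; rewrite ltW.
  move=> t [t0 /eigenvalueP [v vE v0]].
  have vv : 0 < dotv v^T v^T.
    rewrite -sqr_norm2 exprn_gt0// lt0r norm2_eq0 norm2_ge0 andbT.
    by apply: contraNneq v0 => v0; rewrite -[v]trmxK v0 trmx0.
  have := lowM2 v^T; rewrite (dotv_mulmxl M) mulmxA.
  have -> : M^T *m M *m v^T = t ^+ 2 *: v^T.
    by apply: trmx_inj; rewrite trmx_mul trmx_mul !trmxK vE linearZ /= trmxK.
  by rewrite dotvZr ler_pM2r// ler_sqr ?nnegrE// ltW.
by rewrite sE invrK.
Qed.

End PseudoInverse.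

(** * Row sampling and the QDEIM choice of rows *)

Section Sampling.
Context {R : realType}.

Lemma leading_left_singular_orthonormal n m k (A : 'M[R]_(n, m))
    (U : 'M[R]_(n, k)) :
  leading_left_singular A U -> U^T *m U = 1%:M.
Proof.
move=> [kn [W [D [V [[WW _ _ _ _] UW]]]]]; apply/matrixP => i j.
have := congr1 (fun X : 'M[R]_n => X (widen_ord kn i) (widen_ord kn j)) WW.
rewrite !mxE -val_eqE /= val_eqE => <-; apply: eq_bigr => l _.
by rewrite !mxE (UW l i (widen_ord kn i))// (UW l j (widen_ord kn j)).
Qed.

Lemma sampling_mx_tr q n (idx : 'I_q -> 'I_n) : injective idx ->
  sampling_mx R idx *m (sampling_mx R idx)^T = 1%:M.
Proof.
move=> idx_inj; apply/matrixP => i j; rewrite !mxE (bigD1 (idx i))//= !mxE eqxx.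
rewrite mul1r big1 ?addr0 => [|k ki]; first by rewrite inj_eq// eq_sym.
by rewrite !mxE eq_sym (negPf ki) mul0r.
Qed.

Lemma sampling_mulmx q n p (idx : 'I_q -> 'I_n) (A : 'M[R]_(n, p)) k j :
  (sampling_mx R idx *m A) k j = A (idx k) j.
Proof.
rewrite mxE (bigD1 (idx k))//= mxE eqxx mul1r big1 ?addr0// => l lk.
by rewrite mxE eq_sym (negPf lk) mul0r.
Qed.

Lemma qdeim_injective n q (U : 'M[R]_(n, q)) (idx : 'I_q -> 'I_n) :
  (q <= n)%N -> qdeim_indices U idx -> injective idx.
Proof.
move=> qn [s [Q [T [_ idxE]]]] i j.
rewrite (idxE i (widen_ord qn i))// (idxE j (widen_ord qn j))//.
by move=> /perm_inj /(congr1 val) /= ij; exact: val_inj.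
Qed.

(** [T] has orthonormal rows. Under greedy pivoting a zero diagonal entry would make its whole row
    zero, so the leading square block of [T] is triangular with nonzero diagonal, and [S U] is its
    transpose times [Q^T]. *)
Lemma qdeim_unitmx n q (U : 'M[R]_(n, q)) (idx : 'I_q -> 'I_n) :
  (q <= n)%N -> U^T *m U = 1%:M -> qdeim_indices U idx ->
  sampling_mx R idx *m U \in unitmx.
Proof.
move=> qn UU [s [Q [T [[QQ UT Ttri piv] idxE]]]].
have TE : T = Q^T *m col_perm s U^T by rewrite UT mulmxA QQ mul1mx.
have TT : T *m T^T = 1%:M.
  have PP : perm_mx s^-1 *m (perm_mx s^-1)^T = 1%:M :> 'M[R]_n.
    by rewrite tr_perm_mx -perm_mxM mulgV perm_mx1.
  rewrite TE col_permE !trmx_mul !trmxK -!mulmxA (mulmxA (perm_mx _)) PP mul1mx.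
  by rewrite (mulmxA U^T) UU mul1mx.
have Tkk k : T k (widen_ord qn k) != 0.
  apply/eqP => Tkk0.
  have Tk j : T k j = 0.
    have [jk|kj] := ltnP j k; first exact: Ttri.
    (* In the pivot column all entries from row [k] down vanish, so its maximality makes them vanish
       in every later column. *)
    have : T k j ^+ 2 <= 0.
      have := piv k (widen_ord qn k) j erefl kj.
      rewrite [leRHS]big1 => [|i ki]; last first.
        have [->|ik] := eqVneq i k; first by rewrite Tkk0 expr0n.
        by rewrite Ttri ?expr0n//= ltn_neqAle eq_sym ik.
      by apply: le_trans; rewrite (bigD1 k)//= lerDl sumr_ge0// => i _;
        exact: sqr_ge0.
    by rewrite le_eqVlt ltNge sqr_ge0 orbF sqrf_eq0 => /eqP.
  have /matrixP /(_ k k) := TT; rewrite !mxE eqxx big1 => [/esym/eqP|i _].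
    by rewrite oner_eq0.
  by rewrite Tk mul0r.
pose L : 'M[R]_q := \matrix_(i, k) T k (widen_ord qn i).
have BE : sampling_mx R idx *m U = L *m Q^T.
  apply/matrixP => k j; rewrite sampling_mulmx (idxE k (widen_ord qn k))//.
  have /matrixP /(_ j (widen_ord qn k)) := UT; rewrite !mxE => ->.
  by apply: eq_bigr => i _; rewrite !mxE mulrC.
rewrite BE unitmx_mul unitmx_tr; apply/andP; split; last first.
  by have /mulmx1_unit [] := QQ.
rewrite unitmxE det_trig.
  by rewrite unitfE; apply/prodf_neq0 => i _; rewrite mxE.
by apply/is_trig_mxP => i j ij; rewrite mxE Ttri.
Qed.

(** * Lower bound for sampling on vectors close to the range of [U] *)

Section ObliqueBound.
Variables (n q : nat) (S : 'M[R]_(q, n)) (U : 'M[R]_(n, q)).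
Hypotheses (q0 : (0 < q)%N) (SS : S *m S^T = 1%:M) (UU : U^T *m U = 1%:M).
Hypothesis uB : S *m U \in unitmx.
Let kap := specnorm (invmx (S *m U)).
Let Pi := U *m U^T.

Lemma isometry_norm2 k l (A : 'M[R]_(k, l)) v : A^T *m A = 1%:M ->
  norm2 (A *m v) = norm2 v.
Proof.
move=> AA; apply/eqP; rewrite eq_le !norm2_le dotv_mulmxl mulmxA AA mul1mx.
by rewrite lexx.
Qed.

Lemma coisometry_contract k l (A : 'M[R]_(k, l)) :
  A *m A^T = 1%:M -> opbound A 1.
Proof.
move=> AA; rewrite -[A]trmxK; apply: opbound_tr => // v.
by rewrite isometry_norm2 ?mul1r// trmxK.
Qed.

Lemma kappa_lower v : norm2 v <= kap * norm2 (S *m U *m v).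
Proof.
by rewrite -{1}(mul1mx v) -(mulVmx uB) -(mulmxA (invmx _)); exact: specnormP.
Qed.

(** [S U] is an isometry followed by a contraction, so its inverse does not shrink vectors. This
    makes [kap ^+ 2 - 1] a genuine radicand. *)
Lemma kappa_ge1 : 1 <= kap.
Proof.
have [v v0] := @exists_norm2_gt0 R _ q0.
rewrite -(ler_pM2r v0) mul1r (le_trans (kappa_lower v))//.
rewrite ler_wpM2l ?specnorm_ge0// -mulmxA -(isometry_norm2 v UU) -[leRHS]mul1r.
exact: coisometry_contract.
Qed.

Lemma kappa_gt0 : 0 < kap.
Proof. exact: lt_le_trans ltr01 kappa_ge1. Qed.

Lemma Pi_tr : Pi^T = Pi.
Proof. by rewrite trmx_mul trmxK. Qed.

Lemma Pi_idem : Pi *m Pi = Pi.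
Proof. by rewrite mulmxA -(mulmxA U) UU mulmx1. Qed.

Lemma compl_tr : (1%:M - Pi)^T = 1%:M - Pi.
Proof. by rewrite raddfB /= trmx1 Pi_tr. Qed.

Lemma compl_idem : (1%:M - Pi) *m (1%:M - Pi) = 1%:M - Pi.
Proof. by rewrite mulmxBl mul1mx mulmxBr mulmx1 Pi_idem subrr subr0. Qed.

Lemma compl_contract : opbound (1%:M - Pi) 1.
Proof. exact: proj_contract compl_tr compl_idem. Qed.

Lemma pythagoras v :
  norm2 v ^+ 2 = norm2 (U^T *m v) ^+ 2 + norm2 ((1%:M - Pi) *m v) ^+ 2.
Proof.
rewrite !sqr_norm2 (dotv_mulmxl (1%:M - Pi)) compl_tr (mulmxA _ _ v).
rewrite compl_idem mulmxBl mul1mx dotvDr dotvNr dotv_mulmxl trmxK mulmxA.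
by rewrite addrC subrK.
Qed.

(* (S (1 - Pi)) (S (1 - Pi))^T = 1 - B B^T, and B^T is bounded below by 1/kappa *)
Lemma sampling_compl :
  opbound (S *m (1%:M - Pi)) (Num.sqrt (kap ^+ 2 - 1) / kap).
Proof.
have k0 := kappa_gt0; have k1 := kappa_ge1.
have c0 : 0 <= Num.sqrt (kap ^+ 2 - 1) / kap by rewrite divr_ge0 ?sqrtr_ge0 ?ltW.
rewrite -[S *m _]trmxK; apply: opbound_tr => // w.
rewrite trmx_mul compl_tr norm2_leM// expr_div_n sqr_sqrtr; last first.
  by rewrite subr_ge0 exprn_ege1.
rewrite dotv_mulmxl trmx_mul trmxK compl_tr.
rewrite !mulmxA -(mulmxA S) compl_idem mulmxBr mulmx1.
rewrite mulmxBl SS mulmxBl mul1mx dotvDr dotvNr.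
have -> : S *m Pi *m S^T *m w = S *m U *m ((S *m U)^T *m w).
  by rewrite trmx_mul !mulmxA.
rewrite dotv_mulmxr.
have : norm2 w <= kap * norm2 ((S *m U)^T *m w).
  have {1}-> : w = (invmx (S *m U))^T *m ((S *m U)^T *m w).
    by rewrite mulmxA -trmx_mul mulmxV// trmx1 mul1mx.
  by apply: opbound_tr; [exact: specnorm_ge0|exact: specnormP].
rewrite norm2_leM ?(ltW k0)// mulrBl mul1r mulrV ?unitfE ?sqrf_eq0 ?gt_eqF//.
rewrite -ler_pdivrMl ?exprn_gt0// mulrBl mul1r => h.
by rewrite lerB.
Qed.

(** After squaring, positivity reads [(kap^2 - 1) tau^2 < 1 - tau^2], that is, [kap tau < 1]. *)
Lemma Gamma_den_gt0 tau : 0 <= tau -> kap * tau < 1 -> 0 < Gamma_den kap tau.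
Proof.
move=> t0 kt; have k1 := kappa_ge1.
have kt2 : (kap * tau) ^+ 2 < 1 by rewrite expr_lt1// mulr_ge0// ltW// kappa_gt0.
have t2 : tau ^+ 2 <= (kap * tau) ^+ 2.
  by rewrite exprMn ler_peMl ?sqr_ge0// exprn_ege1.
rewrite /Gamma_den subr_gt0 -[tau in ltLHS]ger0_norm// -sqrtr_sqr.
rewrite -sqrtrM ?subr_ge0 ?exprn_ege1// ltr_sqrt ?subr_gt0 ?(le_lt_trans t2)//.
by rewrite mulrBl mul1r ltrD2r -exprMn.
Qed.

Lemma Gamma_gt0 tau : 0 <= tau -> kap * tau < 1 -> 0 < Gamma kap tau.
Proof. by move=> t0 kt; rewrite divr_gt0 ?kappa_gt0 ?Gamma_den_gt0. Qed.

Lemma sampling_lower tau v : 0 <= tau -> kap * tau < 1 ->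
  norm2 ((1%:M - Pi) *m v) <= tau * norm2 v ->
  norm2 v <= Gamma kap tau * norm2 (S *m v).
Proof.
move=> t0 kt hv; have k0 := kappa_gt0; have k1 := kappa_ge1.
rewrite /Gamma mulrAC ler_pdivlMr ?Gamma_den_gt0// mulrC.
set a := norm2 v; set s := norm2 ((1%:M - Pi) *m v).
have a0 : 0 <= a := norm2_ge0 v.
have t1 : tau ^+ 2 <= 1.
  rewrite expr_le1// (le_trans _ (ltW kt))// ler_peMl//.
have hu : Num.sqrt (1 - tau ^+ 2) * a <= norm2 (U^T *m v).
  rewrite -(ler_pXn2r (n:=2))// ?nnegrE ?norm2_ge0 ?mulr_ge0 ?sqrtr_ge0//.
  rewrite exprMn sqr_sqrtr ?subr_ge0//.
  have : s ^+ 2 <= (tau * a) ^+ 2 by rewrite ler_sqr ?nnegrE ?norm2_ge0 ?mulr_ge0.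
  by have := pythagoras v; rewrite -/a -/s exprMn => ->; lra.
have hU := kappa_lower (U^T *m v).
have hS : norm2 (S *m U *m (U^T *m v)) <=
    norm2 (S *m v) + Num.sqrt (kap ^+ 2 - 1) / kap * s.
  (* A second copy of the idempotent complement is inserted, so that [sampling_compl] yields a
     multiple of [s] and not merely of [a]. *)
  have -> : S *m U *m (U^T *m v) =
      S *m v - S *m (1%:M - Pi) *m ((1%:M - Pi) *m v).
    rewrite [S *m (1%:M - Pi) *m _]mulmxA -(mulmxA S (1%:M - Pi)) compl_idem.
    by rewrite mulmxBr mulmx1 mulmxBl opprB addrC subrK !mulmxA.
  rewrite (le_trans (norm2B _ _))// lerD2l; exact: sampling_compl.
have {}hS : kap * norm2 (S *m U *m (U^T *m v)) <=
    kap * norm2 (S *m v) + Num.sqrt (kap ^+ 2 - 1) * s.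
  rewrite (le_trans (ler_wpM2l (ltW k0) hS))// mulrDr lerD2l mulrA mulrCA.
  by rewrite mulfV ?gt_eqF// mulr1.
have hs : Num.sqrt (kap ^+ 2 - 1) * s <= Num.sqrt (kap ^+ 2 - 1) * (tau * a).
  by rewrite ler_wpM2l ?sqrtr_ge0.
rewrite /Gamma_den mulrBl; lra.
Qed.

End ObliqueBound.

(* The projection [Psi X S] onto the range of [Psi] is oblique; its complement
   has the same norm bound [g], which is why [e_perp] is not counted twice. *)
Lemma stationary_error n q p (S : 'M[R]_(q, n)) (Psi : 'M[R]_(n, p)) X g
    (e : 'cV[R]_n) (eta : 'cV[R]_q) :
  S *m S^T = 1%:M -> Psi^T *m Psi = 1%:M -> 1 <= g ->
  penrose (S *m Psi) X -> X *m (S *m Psi) = 1%:M -> opbound X g ->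
  norm2 e <= g * (norm2 ((1%:M - Psi *m Psi^T) *m e) + norm2 eta) +
             g ^+ 2 * norm2 (Psi^T *m S^T *m (S *m e + eta)).
Proof.
move=> SS PP g1 [_ XMX MXs _] XM hX.
have g0 : 0 <= g := le_trans ler01 g1.
set ep := (1%:M - Psi *m Psi^T) *m e; set r := _ *m (S *m e + eta).
have hXt := opbound_tr g0 hX.
have hS := coisometry_contract SS.
(* [X X^T] is the inverse Gram matrix of [S Psi]: it turns the normal-equation residual [r] into the
   least-squares correction. *)
have rE : X *m (X^T *m r) = X *m (S *m e + eta).
  rewrite /r -trmx_mul !mulmxA; congr (_ *m _).
  by rewrite -(mulmxA X) -trmx_mul MXs mulmxA XMX.
have PX : X *m S *m ep = X *m S *m e - Psi^T *m e.
  by rewrite /ep mulmxBl mul1mx mulmxBr !mulmxA -(mulmxA X S Psi) XM mul1mx.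
have Pep : Psi^T *m ep = 0.
  by rewrite mulmxA mulmxBr mulmx1 mulmxA PP mul1mx subrr mul0mx.
have eE : e = (ep - Psi *m (X *m S *m ep)) - Psi *m (X *m eta)
             + Psi *m (X *m (X^T *m r)).
  rewrite rE PX !mulmxDr mulmxN /ep mulmxBl mul1mx !mulmxA.
  set a := Psi *m X *m S *m e; set b := Psi *m X *m eta.
  set c := Psi *m Psi^T *m e.
  by rewrite opprB [e - c + _]addrA subrK -[e - a - b]addrA -opprD subrK.
have PsiN v : norm2 (Psi *m v) = norm2 v by exact: isometry_norm2.
(* [ep] is orthogonal to the range of [Psi], so by Pythagoras it is enough that
   [|X S ep| <= sqrt (g^2 - 1) |ep|]. *)
have h1 : norm2 (ep - Psi *m (X *m S *m ep)) <= g * norm2 ep.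
  (* Since [X S Psi = 1], the adjoint satisfies [|((X S)^T - Psi) w|^2 = |(X S)^T w|^2 - |w|^2 <=
     (g^2 - 1) |w|^2]. *)
  have hw : opbound (X *m S - Psi^T) (Num.sqrt (g ^+ 2 - 1)).
    rewrite -[_ - _]trmxK; apply: opbound_tr; first exact: sqrtr_ge0.
    move=> w; rewrite norm2_leM ?sqrtr_ge0// sqr_sqrtr ?subr_ge0 ?exprn_ege1//.
    have hw : norm2 ((X *m S)^T *m w) <= g * norm2 w.
      rewrite trmx_mul -mulmxA (isometry_norm2 _ (A := S^T)) ?trmxK//.
    move: hw; rewrite norm2_leM// => hw.
    rewrite raddfB /= trmxK mulmxBl !dotv_linear.
    rewrite (dotvC (Psi *m w)) (dotv_mulmxl Psi) (mulmxA Psi^T) PP mul1mx.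
    rewrite (dotv_mulmxl (X *m S)^T w (Psi *m w)) trmxK (mulmxA (X *m S)).
    rewrite -(mulmxA X) XM mul1mx.
    lra.
  have {}hw : norm2 (X *m S *m ep) <= Num.sqrt (g ^+ 2 - 1) * norm2 ep.
    have -> : X *m S *m ep = (X *m S - Psi^T) *m ep.
      by rewrite mulmxBl Pep subr0.
    exact: hw.
  move: hw; rewrite !norm2_leM ?sqrtr_ge0// sqr_sqrtr ?subr_ge0 ?exprn_ege1//.
  set w := X *m S *m ep => hw; rewrite !dotv_linear (dotvC (Psi *m w)).
  have -> : dotv ep (Psi *m w) = 0.
    by rewrite dotv_mulmxr Pep -(scale0r (0 : 'cV[R]_p)) dotvZl mul0r.
  rewrite (dotv_mulmxl Psi) (mulmxA Psi^T) PP mul1mx; lra.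
have h2 : norm2 (Psi *m (X *m eta)) <= g * norm2 eta by rewrite PsiN.
have h3 : norm2 (Psi *m (X *m (X^T *m r))) <= g ^+ 2 * norm2 r.
  rewrite PsiN (le_trans (hX _))// expr2 -mulrA ler_wpM2l//.
rewrite {1}eE (le_trans (norm2D _ _))// lerD// mulrDr.
by rewrite (le_trans (norm2B _ _))// lerD.
Qed.

End Sampling.

(** * The size of a contraction [A] on the range of a matrix, and its continuity at constant rank *)

Section RangeGap.
Context {R : realType}.
Variables (n : nat) (A : 'M[R]_n).
Hypothesis A1 : opbound A 1.

(** For [A = 1 - Pi_q] and [G] the Jacobian this is [tau_q]. *)
Definition range_gap (d : nat) (G : 'M[R]_(n, d)) : R :=
  specnorm (A *m G *m pinv2 G).

(** [G G^+] is the identity on range(G). With [range_gap_le], this makes the gap the least [c >= 0]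
    such that [|A u| <= c |u|] on range(G). *)
Lemma range_gapP d (G : 'M[R]_(n, d)) w :
  norm2 (A *m (G *m w)) <= range_gap G * norm2 (G *m w).
Proof.
have [GXG _ _ _] := pinv2P G.
rewrite -{1}GXG -!mulmxA (mulmxA G) (mulmxA A).
by rewrite (mulmxA A G); exact: specnormP.
Qed.

Lemma range_gap_le d (G : 'M[R]_(n, d)) c : 0 <= c ->
  (forall w, norm2 (A *m (G *m w)) <= c * norm2 (G *m w)) -> range_gap G <= c.
Proof.
move=> c0 hc; apply: specnorm_le => // v.
rewrite -!mulmxA (le_trans (hc _))// ler_wpM2l// mulmxA -[leRHS]mul1r.
exact: (penrose_contract (pinv2P G)).
Qed.

Lemma range_gap_le1 d (G : 'M[R]_(n, d)) : range_gap G <= 1.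
Proof. by apply: range_gap_le => // w; exact: A1. Qed.

(* [z |-> G G0^+ z] moves vectors of range(G0) by at most delta, hence maps
   range(G0) injectively, so by equality of the ranks onto range(G) *)
Lemma range_gap_perturb d (G G0 : 'M[R]_(n, d)) delta :
  \rank G = \rank G0 -> 0 <= delta < 1 ->
  opbound ((G - G0) *m pinv2 G0) delta ->
  `|range_gap G - range_gap G0| <= delta *+ 2.
Proof.
move=> rGG0 /andP[d0 d1] hd; have [GXG _ _ _] := pinv2P G0.
set X0 := pinv2 G0 in hd GXG *.
have shift w : G *m X0 *m (G0 *m w) =
    G0 *m w + (G - G0) *m X0 *m (G0 *m w).
  rewrite !mulmxBl; set a := G *m X0 *m _.
  by rewrite (mulmxA (G0 *m X0)) GXG addrC subrK.
have close w : norm2 (G *m X0 *m (G0 *m w) - G0 *m w) <= delta * norm2 (G0 *m w).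
  by rewrite shift addrAC subrr add0r; exact: hd.
have lower w : (1 - delta) * norm2 (G0 *m w) <= norm2 (G *m X0 *m (G0 *m w)).
  have := norm2B (G *m X0 *m (G0 *m w)) (G *m X0 *m (G0 *m w) - G0 *m w).
  rewrite opprB addrCA subrr addr0.
  by have := close w; lra.
(* Dimension count: by [lower] the kernel of [K] lies in that of [G0], so [K] has at least the rank
   of [G0], which is that of [G]; as range(K) lies in range(G), the two coincide. *)
have [C GC] : exists C, G = G *m X0 *m G0 *m C.
  pose K := G *m X0 *m G0.
  have KG : (K^T <= G^T)%MS.
    by rewrite /K -mulmxA trmx_mul submxMl.
  have kerK : (kermx K^T <= kermx G0^T)%MS.
    apply/rV_subP => v /sub_kermxP vK; apply/sub_kermxP.
    have Kv : K *m v^T = 0 by apply: trmx_inj; rewrite trmx_mul trmxK trmx0.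
    have /eqP : norm2 (G0 *m v^T) = 0.
      apply/eqP; rewrite eq_le norm2_ge0 andbT.
      have := lower v^T; rewrite (mulmxA (G *m X0)) -/K Kv norm2_0.
      by rewrite pmulr_rle0// subr_gt0.
    rewrite norm2_eq0 => /eqP Gv; apply: trmx_inj.
    by rewrite trmx_mul trmxK trmx0.
  have rK : (\rank G^T <= \rank K^T)%N.
    have := mxrankS kerK; rewrite !mxrank_ker !mxrank_tr rGG0.
    have := rank_leq_col G0; have := rank_leq_col K; move: (\rank _) (\rank _).
    by move=> a b ad bd; rewrite leq_sub2lE.
  have : (G^T <= K^T)%MS.
    by have := mxrank_leqif_sup KG => -[_ <-]; rewrite eqn_leq rK mxrankS.
  move=> /submxP [C GC]; exists C^T; apply: trmx_inj.
  by rewrite GC -[C in LHS]trmxK -trmx_mul.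
have t0 := specnorm_ge0 (A *m G0 *m X0).
have t1 := specnorm_ge0 (A *m G *m pinv2 G).
(* A vector of range(G) is the image of some [z] in range(G0), whose norm is larger by at most the
   factor [1 / (1 - delta)]. *)
have le1 : range_gap G <= (range_gap G0 + delta) / (1 - delta).
  apply: range_gap_le => [|w].
    by apply: divr_ge0; [exact: addr_ge0|rewrite subr_ge0 ltW].
  set z := G0 *m (C *m w).
  have -> : G *m w = G *m X0 *m z by rewrite {1}GC -!mulmxA.
  rewrite mulrAC ler_pdivlMr ?subr_gt0//.
  have Av : norm2 (A *m (G *m X0 *m z)) <= (range_gap G0 + delta) * norm2 z.
    rewrite -[G *m X0 *m z](subrK z) mulmxDr (le_trans (norm2D _ _))//.
    rewrite mulrDl addrC lerD//; first exact: range_gapP.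
    by rewrite (le_trans (A1 _))// mul1r; exact: close.
  have d1' : 0 <= 1 - delta by rewrite subr_ge0 ltW.
  apply: (le_trans (ler_wpM2r d1' Av)); rewrite -mulrA.
  by apply: ler_wpM2l; [exact: addr_ge0|rewrite mulrC; exact: lower].
have le2 : range_gap G0 <= range_gap G * (1 + delta) + delta.
  apply: range_gap_le => [|w].
    by rewrite addr_ge0// mulr_ge0// addr_ge0.
  set z := G0 *m w; rewrite -[z in leLHS](subKr (G *m X0 *m z)) mulmxBr.
  rewrite (le_trans (norm2B _ _))// mulrDl lerD//; last first.
    by rewrite (le_trans (A1 _))// mul1r; exact: close.
  rewrite -mulmxA (le_trans (range_gapP _ _))// -mulrA ler_wpM2l//.
  rewrite mulmxA -[G *m X0 *m z](subrK z) (le_trans (norm2D _ _))//.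
  by rewrite mulrDl mul1r addrC lerD2l; exact: close.
rewrite ler_pdivlMr ?subr_gt0// in le1.
have g1 := range_gap_le1 G; have g2 := range_gap_le1 G0.
rewrite -/(range_gap G) in t1; rewrite -/(range_gap G0) in t0.
(* As gaps are at most 1, each of [le1] and [le2] loses at most [delta + delta]. *)
have e1 : delta * range_gap G <= delta by rewrite ler_piMr.
by rewrite ler_norml; apply/andP; split; rewrite mulr2n; lra.
Qed.

Lemma range_gap_continuous (T : topologicalType) d (p : nat)
    (F : T -> 'M[R]_(n, d)) (B : set T) : (forall t, B t -> \rank (F t) = p) ->
  {within B, continuous F} -> {within B, continuous (fun t => range_gap (F t))}.
Proof.
move=> rF /subspace_continuousP cF; apply/subspace_continuousP => t0 Bt0.
have [c c0 hc] := opbound_exists (pinv2 (F t0)).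
apply/cvgrPdist_le => e e0.
(* The bound [e / 2] absorbs the factor 2 of the perturbation lemma and [1/2] keeps [delta < 1]. In
   [e'], [c] pays for the pseudoinverse and [n * d] for summing the entries; the successor avoids
   dividing by 0. *)
pose delta := Num.min (e / 2) (2^-1); pose e' : R := delta / c / (n * d).+1%:R.
have delta0 : 0 < delta by rewrite lt_min divr_gt0//= invr_gt0.
have e'0 : 0 < e' by rewrite !divr_gt0.
have /cvg_ballP /(_ e' e'0) := cF t0 Bt0.
rewrite !near_withinE => hF; apply: filterS hF => t hF Bt.
have {hF} ballF := hF Bt.
rewrite distrC (le_trans (range_gap_perturb (delta := delta) _ _ _))//.
- by rewrite (rF _ Bt) (rF _ Bt0).
- by rewrite ltW//= gt_min; apply/orP; right; lra.
- have -> : delta = delta / c * c by rewrite mulfVK ?gt_eqF.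
  apply: opboundM => //; first by rewrite ltW// divr_gt0.
  move=> v; rewrite (le_trans (opbound_l1 _ _))// ler_wpM2r ?norm2_ge0//.
  apply: (@le_trans _ _ (\sum_(i < n) \sum_(j < d) e')).
    apply: ler_sum => i _; apply: ler_sum => j _; rewrite !mxE.
    have [_ /(_ i j)] := ballF; rewrite /ball /= distrC; exact: ltW.
  rewrite !sumr_const !card_ord -mulrnA -mulr_natr mulnC /e'.
  rewrite mulrAC ler_pdivrMr ?ltr0n// ler_wpM2l ?ler_nat//.
  by rewrite ltW// divr_gt0.
- rewrite -mulr_natr -ler_pdivlMr// ge_min lexx//.
Qed.

End RangeGap.

(** * The stability constant of a Gappy PMD problem *)

Section GappyPMD.
Context {R : realType} {n m q r r1 : nat}.
Variables (D : gpmd_data R n m q r r1) (p : nat) (y : 'cV[R]_q).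
Hypotheses (gD : gappy_pmd D) (tD : tangent_assumptions D y p).

Let q_gt0 : (0 < q)%N.
Proof. by case: tD => _ _ /andP[p0 pq] _ _; exact: leq_trans pq. Qed.

Let p_gt0 : (0 < p)%N.
Proof. by case: tD => _ _ /andP[]. Qed.

Let UU : (podU D)^T *m podU D = 1%:M.
Proof. exact: leading_left_singular_orthonormal (gpmd_pod gD). Qed.

Let qn : (q <= n)%N.
Proof. by have [] := gpmd_pod gD. Qed.

Let SS : Sq D *m (Sq D)^T = 1%:M.
Proof. exact: sampling_mx_tr (qdeim_injective qn (gpmd_qdeim gD)). Qed.

Lemma Bq_unitmx : Bq D \in unitmx.
Proof. exact: qdeim_unitmx qn UU (gpmd_qdeim gD). Qed.
Let uB := Bq_unitmx.

Lemma kappa_sigma_min :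
  0 < sigma_min (Bq D) /\ kappa D = (sigma_min (Bq D))^-1.
Proof. exact: sigma_min_pinv q_gt0 (penrose_invmx uB) (mulVmx uB). Qed.

(** The box contains the training points, and [r1 < m] provides one. The coordinate ranges are
    finite, hence bounded, so their [inf] and [sup] are true bounds. *)
Lemma Theta_neq0 : Theta D !=set0.
Proof.
have m0 : (0 < m)%N := leq_ltn_trans (leq0n _) (gpmd_r1 gD).
exists (train D (Ordinal m0)) => i.
rewrite [theta_lo D i 0]mxE [theta_hi D i 0]mxE.
set t := fun j => train D j i 0.
have bnd j : `|t j| <= \sum_k `|t k|.
  by rewrite (bigD1 j)//= lerDl sumr_ge0.
have M0 := gpmd_margin gD i.
apply/andP; split.
  rewrite lerBlDr ler_wpDr//; apply: ge_inf; last by exists (Ordinal m0).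
  exists (- \sum_k `|t k|) => _ [j _ <-].
  by have := bnd j; rewrite ler_norml => /andP[].
rewrite ler_wpDr//; apply: ub_le_sup; last by exists (Ordinal m0).
exists (\sum_k `|t k|) => _ [j _ <-].
by rewrite (le_trans (ler_norm _)).
Qed.

(** [tau_q] is a range gap of the Jacobian, so constant rank gives continuity on the compact box. *)
Lemma tau_star_attained :
  exists2 theta, Theta D theta & tau_q D y theta = tau_star D y.
Proof.
have [cT cG _ rG _] := tD.
have ctau := range_gap_continuous (compl_contract UU) rG cG.
have [t tT tmax] := compact_EVT_max Theta_neq0 cT ctau.
rewrite inE in tT; exists t => //; apply/eqP; rewrite eq_le; apply/andP; split.
  by apply: ub_le_sup; [exists (tau_q D y t) => _ [s sT <-]; apply: tmax;
    rewrite inE|exists t].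
apply: ge_sup; first by exists (tau_q D y t), t.
by move=> _ [s sT <-]; apply: tmax; rewrite inE.
Qed.

Lemma tau_star_ge0 : 0 <= tau_star D y.
Proof. by have [t _ <-] := tau_star_attained; exact: specnorm_ge0. Qed.

(** Attainment carries the strict pointwise inequality over to the supremum. *)
Lemma kappa_tau_star : kappa D * tau_star D y < 1.
Proof.
by have [t tT <-] := tau_star_attained; have [_ _ _ _] := tD; apply.
Qed.

Let g := Gamma (kappa D) (tau_star D y).

Lemma Gamma_den_star_gt0 : 0 < Gamma_den (kappa D) (tau_star D y).
Proof. exact: Gamma_den_gt0 tau_star_ge0 kappa_tau_star. Qed.

Lemma Gamma_star_gt0 : 0 < g.
Proof. exact: Gamma_gt0 tau_star_ge0 kappa_tau_star. Qed.

(** * Sampling and error on the tangent space at one point of the box *)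

Section AtPoint.
Variables (theta : 'cV[R]_(r1 + r)) (Psi : 'M[R]_(n, p)).
Hypothesis Tt : Theta D theta.
Hypothesis oPsi : orthonormal_range_basis (Gjac D y theta) Psi.
Let X := pinv2 (Sq D *m Psi).

(** [Psi z] lies in the range of the Jacobian, where the complement of [Pi_q] scales by at most
    [tau_q <= tau_star]; then [sampling_lower] applies. *)
Lemma tangent_lower z : norm2 z <= g * norm2 (Sq D *m Psi *m z).
Proof.
have [PP /eqmxP eqPG] := oPsi; have [K PK] : exists K, Psi = Gjac D y theta *m K.
  have : (Psi^T <= (Gjac D y theta)^T)%MS by rewrite eqPG submx_refl.
  move=> /submxP [K PK]; exists K^T.
  by apply: trmx_inj; rewrite PK -[K in LHS]trmxK -trmx_mul.
rewrite -(isometry_norm2 z PP) -mulmxA.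
apply: (sampling_lower q_gt0 SS UU uB tau_star_ge0 kappa_tau_star).
have gap := range_gapP (1%:M - Piq D) (Gjac D y theta) (K *m z).
rewrite (mulmxA (Gjac D y theta)) -PK in gap; apply: (le_trans gap).
(* The supremum [tau_star] is a true upper bound because every gap is at most 1. *)
rewrite ler_wpM2r ?norm2_ge0//; apply: ub_le_sup; last by exists theta.
exists 1 => _ [s _ <-].
exact (range_gap_le1 (compl_contract UU) (Gjac D y s)).
Qed.

Let pX : penrose (Sq D *m Psi) X := pinv2P _.

(** [tangent_lower] makes [S Psi] injective, so its pseudoinverse is a left inverse. *)
Let XM : X *m (Sq D *m Psi) = 1%:M.
Proof.
apply: pinv_left_inverse pX; rewrite -kermx_eq0; apply/rowV0P => v.
move=> /sub_kermxP vM; apply/eqP; rewrite -trmx_eq0 -norm2_eq0 eq_le norm2_ge0.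
rewrite andbT (le_trans (tangent_lower _))//.
have -> : Sq D *m Psi *m v^T = 0.
  by apply: trmx_inj; rewrite trmx_mul trmxK vM trmx0.
by rewrite norm2_0 mulr0.
Qed.

(** [|X v| <= g |S Psi X v| <= g |v|], as [S Psi X] is an orthogonal projection. *)
Let hX : opbound X g.
Proof.
move=> v; rewrite (le_trans (tangent_lower _))//.
rewrite ler_wpM2l ?(ltW Gamma_star_gt0)//.
by rewrite mulmxA -[leRHS]mul1r; exact: penrose_contract.
Qed.

Lemma Lambda_sigma_min : 0 < sigma_min (Sq D *m Psi) /\
  Lambda D Psi = (sigma_min (Sq D *m Psi))^-1.
Proof. exact: sigma_min_pinv p_gt0 pX XM. Qed.

Lemma Lambda_le : Lambda D Psi <= g.
Proof. exact: specnorm_le (ltW Gamma_star_gt0) hX. Qed.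

Lemma err_le x eta : y = measure_state D x eta ->
  norm2 (err D x y theta) <=
    g * (norm2 (err_perp D Psi x y theta) + norm2 eta) +
    g ^+ 2 * norm2 (r_stat D Psi y theta).
Proof.
move=> yE; have [PP _] := oPsi.
(* [S Psi] is a contraction on a nonzero space, so a lower bound [1/g] for it has [g >= 1]. *)
have g1 : 1 <= g.
  have [z z0] := @exists_norm2_gt0 R _ p_gt0.
  rewrite -(ler_pM2r z0) mul1r (le_trans (tangent_lower z))//.
  rewrite ler_wpM2l ?(ltW Gamma_star_gt0)// -mulmxA -(isometry_norm2 z PP).
  by rewrite -[leRHS]mul1r; exact: coisometry_contract.
have := stationary_error (err D x y theta) eta SS PP g1 pX XM hX.
have -> // : Sq D *m err D x y theta + eta = y - Sq D *m recon D y theta.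
by rewrite /err {2}yE /measure_state mulmxBr addrAC.
Qed.

End AtPoint.
End GappyPMD.

Theorem corollary3 (R : realType) :
  (forall (n m q r r1 p : nat) (D : gpmd_data R n m q r r1)
          (x : 'cV[R]_n) (eta y : 'cV[R]_q)
          (Psi : 'cV[R]_(r1 + r) -> 'M[R]_(n, p)),
     gappy_pmd D ->
     y = measure_state D x eta ->
     tangent_assumptions D y p ->
     (forall theta, Theta D theta ->
        orthonormal_range_basis (Gjac D y theta) (Psi theta)) ->
     [/\ [/\ Bq D \in unitmx, 0 < sigma_min (Bq D) &
             kappa D = (sigma_min (Bq D))^-1],
         (exists2 theta, Theta D theta & tau_q D y theta = tau_star D y) /\
         0 <= tau_star D y < (kappa D)^-1,
         (forall theta, Theta D theta ->
            0 < sigma_min (Sq D *m Psi theta) /\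
            Lambda D (Psi theta) = (sigma_min (Sq D *m Psi theta))^-1),
         (ereal_sup [set (Lambda D (Psi theta))%:E | theta in Theta D]
            <= (Gamma (kappa D) (tau_star D y))%:E)%E /\
         0 < Gamma_den (kappa D) (tau_star D y) &
         (forall theta, Theta D theta ->
            norm2 (err D x y theta) <=
              Gamma (kappa D) (tau_star D y) *
                (norm2 (err_perp D (Psi theta) x y theta) + norm2 eta) +
              Gamma (kappa D) (tau_star D y) ^+ 2 *
                norm2 (r_stat D (Psi theta) y theta))])
  /\
  (forall (n m q r r1 p : nat -> nat)
          (D : forall j, gpmd_data R (n j) (m j) (q j) (r j) (r1 j))
          (x : forall j, 'cV[R]_(n j)) (eta y : forall j, 'cV[R]_(q j))
          (theta : forall j, 'cV[R]_(r1 j + r j))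
          (Psi : forall j, 'M[R]_(n j, p j)),
     (forall j, gappy_pmd (D j)) ->
     (forall j, y j = measure_state (D j) (x j) (eta j)) ->
     (forall j, tangent_assumptions (D j) (y j) (p j)) ->
     (forall j, Theta (D j) (theta j)) ->
     (forall j,
        orthonormal_range_basis (Gjac (D j) (y j) (theta j)) (Psi j)) ->
     (ereal_sup (range (fun j =>
        (Gamma (kappa (D j)) (tau_star (D j) (y j)))%:E)) < +oo)%E ->
     norm2 (err_perp (D j) (Psi j) (x j) (y j) (theta j)) @[j --> \oo]
       --> (0 : R) ->
     norm2 (eta j) @[j --> \oo] --> (0 : R) ->
     norm2 (r_stat (D j) (Psi j) (y j) (theta j)) @[j --> \oo] --> (0 : R) ->
     norm2 (err (D j) (x j) (y j) (theta j)) @[j --> \oo] --> (0 : R)).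
Proof.
split.
  move=> n m q r r1 p D x eta y Psi gD yE tD oPsi.
  have [s0 kE] := kappa_sigma_min gD tD.
  have k0 : 0 < kappa D by rewrite kE invr_gt0.
  split.
  - by split => //; exact: Bq_unitmx gD.
  - split; first exact: tau_star_attained gD tD.
    rewrite (tau_star_ge0 gD tD)/= -[ltRHS]mul1r ltr_pdivlMr// mulrC.
    exact: kappa_tau_star gD tD.
  - by move=> theta Tt; exact (Lambda_sigma_min gD tD Tt (oPsi _ Tt)).
  - split; last exact: Gamma_den_star_gt0 gD tD.
    apply: ge_ereal_sup => _ [theta Tt <-]; rewrite lee_fin.
    exact (Lambda_le gD tD Tt (oPsi _ Tt)).
  - by move=> theta Tt; exact (err_le gD tD Tt (oPsi _ Tt) yE).
move=> n m q r r1 p D x eta y theta Psi gD yE tD Tt oPsi supG ep0 eta0 rs0.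
pose g j := Gamma (kappa (D j)) (tau_star (D j) (y j)).
have g0 j : 0 < g j := Gamma_star_gt0 (gD j) (tD j).
have [c c0 gc] : exists2 c, 0 < c & forall j, g j <= c.
  have gS j : ((g j)%:E <= ereal_sup (range (fun j => (g j)%:E)))%E.
    by apply: ereal_sup_ubound; exists j.
  (* A finite supremum bounds every [g j] and is positive because [g 0] is; [+oo] contradicts
     [supG], and [-oo] the presence of [g 0]. *)
  move: supG gS; rewrite -/g; case: (ereal_sup _) => [c _ gS| |_ gS].
  - exists c => [|j]; last by have := gS j; rewrite lee_fin.
    by rewrite (lt_le_trans (g0 0%N))//; have := gS 0%N; rewrite lee_fin.
  - by rewrite ltxx.
  - by have := gS 0%N; rewrite leeNy_eq.
(* The error bound with every stability constant replaced by the uniform [c] tends to 0. *)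
apply: (@squeeze_cvgr _ _ _ _ (fun=> 0) (fun j =>
    c * (norm2 (err_perp (D j) (Psi j) (x j) (y j) (theta j)) + norm2 (eta j)) +
    c ^+ 2 * norm2 (r_stat (D j) (Psi j) (y j) (theta j)))).
- apply: nearW => j; rewrite norm2_ge0/=.
  apply: (le_trans (err_le (gD j) (tD j) (Tt j) (oPsi j) (yE j))).
  apply: lerD; rewrite ler_wpM2r ?norm2_ge0 ?addr_ge0 ?norm2_ge0 ?gc//.
  by rewrite ler_sqr ?nnegrE ?(ltW (g0 j)) ?(ltW c0) ?gc.
- exact: cvg_cst.
- rewrite [X in _ --> X](_ : _ = c * (0 + 0) + c ^+ 2 * 0); last first.
    by rewrite addr0 !mulr0 addr0.
  apply: cvgD; first by apply: cvgMr; apply: cvgD.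
  exact: cvgMr.
Qed.
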